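(* The class $\mathbf{nC}$ is subnormally closed: if $G$ is a finite group in which every normal subgroup is complemented, and $H$ is a subnormal subgroup of $G$, then every normal subgroup of $H$ is complemented in $H$.
   Context: All groups are finite. $\mathbf{nC}$ denotes the class of finite groups $G$ in which every normal subgroup $N$ is complemented, i.e. there is $C\leq G$ with $G=NC$ and $N\cap C=1$. *)

(* Defs.v *)
From mathcomp Require Import all_boot all_fingroup all_solvable.

Set Implicit Arguments.
Unset Strict Implicit.
Unset Printing Implicit Defensive.

Local Open Scope group_scope.

(* A complement C with N :&: C = 1 and N * C = G is automatically contained   *)
(* in G, so [splits_over] does not state it separately.                       *)
Definition nC (gT : finGroupType) (G : {group gT}) : Prop :=
  forall N : {group gT}, N <| G -> [splits G, over N].

(* Main.v *)
Require Import Defs.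
From mathcomp Require Import all_boot all_fingroup all_solvable.

Set Implicit Arguments.
Unset Strict Implicit.
Unset Printing Implicit Defensive.

Local Open Scope group_scope.

(** By induction along the subnormal series it is enough to treat M <| G, and
    this is done by induction on |G|.  Take a minimal normal subgroup A of G
    inside M; it has a complement C in G, and M / A is in nC by induction.  Given
    N <| M, lift a complement of NA / A in M / A to A <= L <= M.  By the argument
    of Clifford's theorem, A is a completely reducible M-group (abelian or not),
    so A = (A :&: N) * B with B an M-invariant subgroup meeting A :&: N trivially.
    Then B * (C :&: L) is a complement of N in M. *)

Lemma nC_quotient (gT : finGroupType) (G A : {group gT}) :
  A <| G -> nC G -> nC (G / A).
Proof.
move=> nsAG nCG Nb /(inv_quotientN nsAG)[N defN sAN nsNG].
have /splitsP[C /complP[tiNC defG]] := nCG N nsNG.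
apply/splitsP; exists (C / A)%G; apply/complP; rewrite defN /=; split.
  (* Since [A] lies in [N], passing to the quotient commutes with intersecting [N] and [C]. *)
  by rewrite -quotientGI // tiNC quotient1.
have nAN : N \subset 'N(A).
  by rewrite (subset_trans (normal_sub nsNG)) ?normal_norm.
by rewrite -quotientMl // defG.
Qed.

(* A maximal M-invariant B <= A meeting K trivially does the job: every
   G-conjugate of a minimal M-invariant T <= A is again minimal, hence lies in
   K * B by maximality of B, and these conjugates generate A. *)
Lemma minnormal_invariant_compl (gT : finGroupType) (G M A K : {group gT}) :
    minnormal A G -> M <| G -> A \subset M -> K \subset A -> M \subset 'N(K) ->
  exists B : {group gT},
    [/\ B \subset A, M \subset 'N(B), K :&: B = 1 & K * B = A].
Proof.
case/mingroupP=> /andP[ntA nAG] minA nsMG sAM sKA nKM.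
have [sMG nMG] := andP nsMG.
have nAM := subset_trans sMG nAG.
have [T minT sTA] := minnormal_exists ntA nAM.
have /mingroupP[/andP[ntT nTM] minTM] := minT.
pose P (X : {group gT}) := [&& X \subset A, M \subset 'N(X) & K :&: X == 1].
have P1 : P 1%G by rewrite /P sub1G norms1 setIC setI1g eqxx.
have [B /maxgroupP[/and3P[sBA nBM /eqP tiKB] maxB] _] := maxgroup_exists P1.
exists B; split=> //.
have nKA := subset_trans sAM nKM; have nBA := subset_trans sAM nBM.
have nKB := subset_trans sBA nKA.
have defKB : K <*> B = K * B := norm_joinEr nKB.
have sKBA : K <*> B \subset A by rewrite join_subG sKA.
have sTKB g : g \in G -> T :^ g \subset K <*> B.
  move=> Gg; have sTgA : T :^ g \subset A.
    by rewrite -(normsP nAG g Gg) conjSg.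
  have nTgM : M \subset 'N(T :^ g).
    by rewrite normJ -{1}(normsP nMG g Gg) conjSg.
  have nKBM : M \subset 'N(K <*> B) by rewrite normsY.
  apply/idPn=> not_sTKB.
  (* Otherwise conjugating this intersection by [g^-1] gives a nontrivial [M]-invariant subgroup of
     [T], hence [T] itself. *)
  have tiTKB : T :^ g :&: K <*> B = 1.
    apply/eqP/idPn=> ntI; case/negP: not_sTKB.
    have sIT : (T :^ g :&: K <*> B) :^ g^-1 \subset T.
      by rewrite sub_conjgV subsetIl.
    have <- : T :^ g :&: K <*> B = T :^ g; last exact: subsetIr.
    apply: (@conjsg_inj _ g^-1); rewrite conjsgK.
    apply: (minTM ((T :^ g :&: K <*> B) :^ g^-1)%G) => //=.
    rewrite -(inj_eq (@conjsg_inj _ g)) conjsgKV conjs1g ntI.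
    by rewrite normJ -(normsP nMG g^-1) ?groupV // conjSg normsI.
  have nBTg : T :^ g \subset 'N(B) := subset_trans sTgA nBA.
  (* Now [B <*> T :^ g] still satisfies [P], so it equals [B]. *)
  case/negP: not_sTKB; rewrite -(maxB (B <*> T :^ g)%G) /=.
  - by rewrite joingA joing_subr.
  - rewrite /P join_subG sBA sTgA normsY //= -subG1 /= norm_joinEr //.
    apply/subsetP=> x /setIP[Kx /mulsgP[b t Bb Tt defx]].
    have t1 : t = 1.
      apply/set1gP; rewrite -tiTKB inE Tt -(mulKg b t) -defx.
      by rewrite groupM ?groupV ?mem_gen // inE ?Bb ?Kx ?orbT.
    by rewrite -tiKB inE Kx defx t1 mulg1.
  - exact: joing_subl.
rewrite -defKB; apply/eqP; rewrite eqEsubset sKBA /=.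
(* The conjugates of [T] generate a nontrivial [G]-invariant subgroup of [A], which is [A] by
   minimality. *)
have sSKB : <<class_support T G>> \subset K <*> B.
  by rewrite gen_subG class_supportEr; apply/bigcupsP=> g /sTKB.
have sTS : T \subset <<class_support T G>>.
  by rewrite sub_gen // sub_class_support.
rewrite -(minA <<class_support T G>>%G _ (subset_trans sSKB sKBA)) //=.
rewrite norms_gen ?class_support_norm // andbT.
by apply: contraNneq ntT => S1; rewrite -subG1 -S1.
Qed.

Lemma nC_normal (gT : finGroupType) (G M : {group gT}) :
  nC G -> M <| G -> nC M.
Proof.
(* The type [gT] varies in the induction because [G / A] lives in another type. *)
have [n] := ubnP #|G|; elim: n gT G M => // n IHn gT G M /ltnSE leGn nCG nsMG.
move=> N nsNM; have [sMG nMG] := andP nsMG; have [sNM nNM] := andP nsNM.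
have [M1 | ntM] := eqVneq (M :> {set gT}) 1.
  have N1 : N :=: 1 by apply/trivgP; rewrite -M1.
  by apply/splitsP; exists M; apply/complP; rewrite N1 M1 setIid mulg1.
have [A minA sAM] := minnormal_exists ntM nMG.
have /mingroupP[/andP[ntA nAG] _] := minA.
have sAG := subset_trans sAM sMG; have nAM := subset_trans sMG nAG.
have nsAG : A <| G by apply/andP.
have nsAM : A <| M by apply/andP.
have nAN := subset_trans sNM nAM.
have /splitsP[C /complP[tiAC defG]] := nCG A nsAG.
have [B [sBA nBM tiB defA]] :=
  minnormal_invariant_compl minA nsMG sAM (subsetIl A N) (normsI nAM nNM).
have ltAG : (#|G / A| < n)%N.
  by apply: leq_trans leGn; rewrite ltn_quotient.
have /splitsP[Lb /complP[tiNLb defMb]] :=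
  IHn _ _ _ ltAG (nC_quotient nsAG nCG) (quotient_normal A nsMG) _
    (quotient_normal A nsNM).
have sLbM : Lb \subset M / A by rewrite -defMb mulG_subr.
have [L defLb sAL sLM] := inv_quotientS nsAM sLbM.
have tiNL : N :&: L \subset A.
  rewrite -quotient_sub1 ?subIset ?nAN // quotientIG // -defLb tiNLb.
  exact: subxx.
have defM : N * L = M.
  apply/eqP; rewrite eqEsubset mul_subG //=.
  have : M / A \subset N * L / A by rewrite quotientMl // -defLb defMb.
  by rewrite quotientSK // mulgA -(normC nAN) -mulgA (mulSGid sAL).
(* Dedekind's law, from [A * C = G] and [A] inside [L]. *)
have defL : A * (C :&: L) = L.
  by rewrite group_modl // defG; apply/setIidPr/(subset_trans sLM sMG).
have sBM := subset_trans sBA sAM.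
have nBCL : C :&: L \subset 'N(B).
  by rewrite subIset // (subset_trans sLM nBM) orbT.
apply/splitsP; exists (B <*> (C :&: L))%G; apply/complP.
have sDL : B * (C :&: L) \subset L.
  by rewrite mul_subG ?subsetIr // (subset_trans sBA).
split.
  (* Dedekind again. As [N :&: L] lies in [A], this puts the intersection with [N] inside
     [A :&: N :&: B], which is trivial. *)
  have tiAD : B * (C :&: L) :&: A = B.
    by rewrite -group_modl // setIAC (setIC C) tiAC setI1g mulg1.
  apply/trivgP; rewrite /= norm_joinEr // -tiB -[X in _ \subset _ :&: X]tiAD.
  have sNDA : N :&: (B * (C :&: L)) \subset A.
    exact: subset_trans (setIS _ sDL) tiNL.
  by rewrite !subsetI sNDA subsetIl subsetIr.
apply/eqP; rewrite /= norm_joinEr // eqEsubset mul_subG ?(subset_trans sDL) //=.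
(* Expand [M = N * L] with [L = (A :&: N) * B * (C :&: L)]; the factor [A :&: N] is absorbed by
   [N]. *)
rewrite -{1}defM mulGS -{1}defL -defA -mulgA mulSg //.
exact: subsetIr.
Qed.

Theorem corollary1p5 (gT : finGroupType) (G H : {group gT}) :
  nC G -> H <|<| G -> nC H.
Proof.
move=> nCG /subnormalP[s].
elim: s H => [|K s IHs] H /= => [_ -> //|/andP[nsHK snK] lastK].
exact: nC_normal (IHs K snK lastK) nsHK.
Qed.
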